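(* Let $n\ge 2$ and let $\Gamma_n\subset E(n)$ be the group generated by $\gamma_0=(I,(1,0,\dots,0))$ and, for $i=1,2,\dots,n-1$, the elements $\gamma_i=(D_i,\tfrac12 e_{i+1})$, where $D_i$ is the diagonal $n\times n$ matrix whose $(i,i)$ entry is $-1$ and whose other diagonal entries are $1$, and $e_1,\dots,e_n$ is the standard basis of $\mathbb{R}^n$. Then the manifold $\mathbb{R}^n/\Gamma_n$ is both a generalized Hantzsche-Wendt manifold and a real Bott manifold, i.e. it belongs to $\mathcal{GHW}\cap\mathcal{RBM}$.
   Context: $E(n)=\mathrm{Isom}(\mathbb{R}^n)=O(n)\ltimes\mathbb{R}^n$ is the group of isometries of Euclidean space; the element $(B,b)$ acts by $x\mapsto Bx+b$, and $I$ denotes the identity matrix. A flat manifold of dimension $n$ is a compact connected Riemannian manifold without boundary with sectional curvature zero; equivalently, a quotient $\mathbb{R}^n/\Gamma$ with $\Gamma\subset E(n)$ discrete, cocompact and torsion free. Its holonomy group is (isomorphic to) the image of $\Gamma$ under the projection $E(n)\to O(n)$. A generalized Hantzsche-Wendt manifold is a flat manifold of dimension $n$ with holonomy group isomorphic to $(\mathbb{Z}_2)^{n-1}$; $\mathcal{GHW}$ denotes the family of these manifolds. A real Bott manifold is the top manifold $M_n$ of a tower $M_n\to M_{n-1}\to\cdots\to M_1\to M_0=\{\text{a point}\}$ of $\mathbb{R}P^1$-bundles in which, for each $i$, $M_i\to M_{i-1}$ is the projective bundle of the Whitney sum of a real line bundle $L_{i-1}$ and the trivial line bundle over $M_{i-1}$.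 $\mathcal{RBM}$ denotes the family of real Bott manifolds. Equivalently, up to (affine) diffeomorphism, the real Bott manifolds of dimension $n$ are the manifolds $M(A)=\mathbb{R}^n/\Gamma(A)$, where $A=[a_{i,j}]$ is a strictly upper triangular $n\times n$ matrix with entries in $\mathbb{Z}_2=\{0,1\}$, and $\Gamma(A)\subset E(n)$ is generated by $s_n=(I,e_n)$ and, for $i=1,\dots,n-1$, by $s_i=(S_i,\tfrac12 e_i)$, where $S_i$ is the diagonal matrix $\mathrm{diag}(1,\dots,1,(-1)^{a_{i,i+1}},\dots,(-1)^{a_{i,n}})$ with $(-1)^{a_{i,m}}$ in position $(m,m)$ for $m>i$ and $1$ in position $(m,m)$ for $m\le i$. Membership in $\mathcal{RBM}$ is understood up to (affine) diffeomorphism. *)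

(* Defs.v *)
From HB Require Import structures.
From mathcomp Require Import all_boot all_order all_algebra.
From mathcomp Require Import all_classical all_reals all_analysis.

Set Implicit Arguments.
Unset Strict Implicit.
Unset Printing Implicit Defensive.

Import Order.TTheory GRing.Theory Num.Theory.
Import numFieldNormedType.Exports.

Local Open Scope classical_set_scope.
Local Open Scope ring_scope.
Local Open Scope quotient_scope.

Record subgroup (G : groupType) := Subgroup {
  subgroup_set :> set G;
  subgroup_closed : group_closed (mem subgroup_set) }.

Lemma group_closed_setP (G : groupType) (H : set G) :
  group_closed (mem H) <->
  H 1%g /\ (forall u v, H u -> H v -> H (u / v)%g).
Proof.
split=> [[H1 HF]|[H1 HF]]; split.
- by move: H1; rewrite inE.
- by move=> u v Hu Hv; have := HF u v; rewrite !inE; exact.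
- by rewrite inE.
- by move=> u v; rewrite !inE; exact: HF.
Qed.

Lemma smallest_group_closed (G : groupType) (S : set G) :
  group_closed (mem (smallest (fun H : set G => group_closed (mem H)) S)).
Proof.
apply/group_closed_setP; split=> [H [/group_closed_setP[]]//|u v Hu Hv H HS].
have /group_closed_setP[_ HF] := HS.1.
by apply: HF; [exact: Hu | exact: Hv].
Qed.

Definition generated (G : groupType) (S : set G) : subgroup G :=
  Subgroup (smallest_group_closed S).

Definition torsion_free (G : groupType) (H : set G) :=
  forall g : G, H g -> forall k : nat, (0 < k)%N ->
    (g ^+ k = 1)%g -> g = 1%g.

Definition discrete_subset (T : topologicalType) (A : set T) :=
  forall x, A x -> isolated A x.

Definition orthogonal_mx (R : realType) n (B : 'M[R]_n) : bool :=
  B *m B^T == 1%:M.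

(* The group E(n); an element (B, b) stands for x |-> B x + b. *)
Record isom (R : realType) (n : nat) := Isom {
  isom_val : 'M[R]_n * 'cV[R]_n;
  isom_orth : orthogonal_mx isom_val.1 }.

Section IsomGroup.
Context {R : realType} {n : nat}.
Local Notation E := (isom R n).

HB.instance Definition _ := [isSub for @isom_val R n].
HB.instance Definition _ := [Choice of E by <:].

Definition lin (g : E) : 'M[R]_n := (isom_val g).1.
Definition transl (g : E) : 'cV[R]_n := (isom_val g).2.

Definition act (g : E) (x : 'cV[R]_n) : 'cV[R]_n := lin g *m x + transl g.

Lemma lin_mulT (g : E) : lin g *m (lin g)^T = 1%:M.
Proof. exact/eqP/isom_orth. Qed.

Lemma lin_Tmul (g : E) : (lin g)^T *m lin g = 1%:M.
Proof. exact: mulmx1C (lin_mulT g). Qed.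

Lemma orth1 : orthogonal_mx (1%:M : 'M[R]_n).
Proof. by rewrite /orthogonal_mx trmx1 mulmx1. Qed.

Lemma orthM (g h : E) : orthogonal_mx (lin g *m lin h).
Proof.
by rewrite /orthogonal_mx trmx_mul mulmxA -(mulmxA (lin g)) lin_mulT mulmx1
  lin_mulT.
Qed.

Lemma orthV (g : E) : orthogonal_mx (lin g)^T.
Proof. by rewrite /orthogonal_mx trmxK lin_Tmul. Qed.

Definition isom_one : E := @Isom R n (1%:M, 0) orth1.

Definition isom_mul (g h : E) : E :=
  @Isom R n (lin g *m lin h, lin g *m transl h + transl g) (orthM g h).

Definition isom_inv (g : E) : E :=
  @Isom R n ((lin g)^T, - ((lin g)^T *m transl g)) (orthV g).

Fact isom_mulA : associative isom_mul.
Proof.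
move=> f g h; apply: val_inj => /=.
by rewrite /lin /transl /= !mulmxA mulmxDr !mulmxA addrA.
Qed.

Fact isom_mul1 : left_id isom_one isom_mul.
Proof.
by move=> g; apply: val_inj; rewrite /= !mul1mx addr0; case: g => -[].
Qed.

Fact isom_mulr1 : right_id isom_one isom_mul.
Proof.
by move=> g; apply: val_inj; rewrite /= mulmx1 mulmx0 add0r; case: g => -[].
Qed.

Fact isom_mulV : left_inverse isom_one isom_inv isom_mul.
Proof. by move=> g; apply: val_inj; rewrite /= lin_Tmul /transl /= subrr. Qed.

Fact isom_mulrV : right_inverse isom_one isom_inv isom_mul.
Proof.
move=> g; apply: val_inj.
by rewrite /= lin_mulT mulmxN mulmxA lin_mulT mul1mx addNr.
Qed.

HB.instance Definition _ := isGroup.Build E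
  isom_mulA isom_mul1 isom_mulr1 isom_mulV isom_mulrV.

(* E(n) carries the subspace topology of matrices x vectors. *)
HB.instance Definition _ :=
  Topological.copy E (initial_topology (@isom_val R n)).

Lemma act1 x : act 1%g x = x.
Proof. by rewrite /act /= mul1mx addr0. Qed.

Lemma actM (g h : E) x : act (g * h)%g x = act g (act h x).
Proof. by rewrite /act /lin /transl /= mulmxDr mulmxA addrA. Qed.

End IsomGroup.

Section OrbitSpace.
Context {R : realType} {n : nat}.
Variable Gam : subgroup (isom R n).

Definition orbit_rel (x y : 'cV[R]_n) : bool :=
  `[< exists2 g, subgroup_set Gam g & y = act g x >].

Fact orbit_rel_equiv : equiv_class_of orbit_rel.
Proof.
have [G1 GF] := (group_closed_setP _).1 (subgroup_closed Gam).
have GV g : subgroup_set Gam g -> subgroup_set Gam (g^-1)%g.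
  by move=> /(GF _ _ G1); rewrite div1g.
have GM g h : subgroup_set Gam g -> subgroup_set Gam h ->
    subgroup_set Gam (g * h)%g.
  by move=> Gg /GV Gh; have := GF _ _ Gg Gh; rewrite invgK.
have sym x y : orbit_rel x y -> orbit_rel y x.
  move=> /asboolP[g Gg ->]; apply/asboolP; exists g^-1%g.
    exact: GV.
  by rewrite -actM mulVg act1.
split=> [x|x y|y x z].
- by apply/asboolP; exists 1%g; [exact: G1 | rewrite act1].
- by apply/idP/idP; exact: sym.
- move=> /asboolP[g Gg ->] /asboolP[h Gh ->]; apply/asboolP.
  exists (h * g)%g; last by rewrite actM.
  exact: GM.
Qed.

Canonical orbit_equiv := EquivRelPack orbit_rel_equiv.

(* R^n / Gam with the quotient topology. *)
Definition orbit_space := quotient_topology {eq_quot orbit_equiv}.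

HB.instance Definition _ := Quotient.on orbit_space.
HB.instance Definition _ := Topological.on orbit_space.

End OrbitSpace.

Section FlatManifolds.
Context {R : realType} {n : nat}.

(* R^n / Gam is a flat manifold of dimension n, with fundamental group Gam. *)
Definition is_flat_manifold (Gam : subgroup (isom R n)) : Prop :=
  [/\ discrete_subset Gam, compact [set: orbit_space Gam] & torsion_free Gam].

Definition holonomy (Gam : subgroup (isom R n)) : set 'M[R]_n := lin @` Gam.

(* The product on the right is that of O(n), which contains the holonomy. *)
Definition holonomy_isog_Z2 (Gam : subgroup (isom R n)) (k : nat) : Prop :=
  exists phi : 'rV['Z_2]_k -> 'M[R]_n,
    [/\ injective phi, range phi = holonomy Gam &
        forall u v, phi (u + v) = phi u *m phi v].

Definition GHW (Gam : subgroup (isom R n)) : Prop :=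
  is_flat_manifold Gam /\ holonomy_isog_Z2 Gam n.-1.

(* A bijection between the quotients induced by an invertible affine map
   x |-> P x + p of R^n. *)
Definition affinely_diffeomorphic (Gam Del : subgroup (isom R n)) : Prop :=
  exists F : orbit_space Gam -> orbit_space Del,
    bijective F /\
    exists (P : 'M[R]_n) (p : 'cV[R]_n), P \in unitmx /\
      forall x, F (\pi_(orbit_space Gam) x) =
                \pi_(orbit_space Del) (P *m x + p).

Definition basis_vec (i : 'I_n) : 'cV[R]_n := delta_mx i 0.

Definition sign_mx (a : 'I_n -> nat) : 'M[R]_n :=
  diag_mx (\row_j (-1) ^+ a j).

Lemma sign_mx_orth (a : 'I_n -> nat) : orthogonal_mx (sign_mx a).
Proof.
rewrite /orthogonal_mx /sign_mx tr_diag_mx mulmx_diag -diag_const_mx.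
by apply/eqP; congr diag_mx; apply/rowP => j; rewrite !mxE -expr2 sqrr_sign.
Qed.

Definition sign_isom (a : 'I_n -> nat) (b : 'cV[R]_n) : isom R n :=
  @Isom R n (sign_mx a, b) (sign_mx_orth a).

Definition translation (b : 'cV[R]_n) : isom R n :=
  @Isom R n (1%:M, b) orth1.

Definition strictly_upper (A : 'M['Z_2]_n) : Prop :=
  forall i j : 'I_n, (j <= i)%N -> A i j = 0.

(* Indices are 0-based: the last generator s_n is the one with i.+1 = n.  The
   entry A i m : 'Z_2 is used as the exponent 0 or 1. *)
Definition bott_gen (A : 'M['Z_2]_n) (i : 'I_n) : isom R n :=
  if i.+1 == n then translation (basis_vec i)
  else sign_isom (fun m => if (i < m)%N then A i m : nat else 0%N)
                 (2^-1 *: basis_vec i).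

Definition bott_group (A : 'M['Z_2]_n) : subgroup (isom R n) :=
  generated (range (bott_gen A)).

Definition RBM (Gam : subgroup (isom R n)) : Prop :=
  exists A : 'M['Z_2]_n,
    strictly_upper A /\ affinely_diffeomorphic Gam (bott_group A).

End FlatManifolds.

(* With 0-based indices, gamma_0 is translation by e_i for i = 0, and the other
   generators are (D_i, e_j / 2) for consecutive i and j = i + 1. *)
Definition Gamma (R : realType) (n : nat) : subgroup (isom R n) :=
  generated
    ([set translation (basis_vec i) | i in [set i : 'I_n | i = 0%N :> nat]] `|`
     [set g | exists i j : 'I_n, j = i.+1 :> nat /\
        g = sign_isom (fun k => k == i) (2^-1 *: basis_vec j)]).

(* Main.v *)
(* Every element of Gamma_n is (diag (-1)^a, b/2) with a in (Z/2)^n, b in Z^n,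
   b_(j+1) = a_j mod 2 and a_n = 0.  Such elements are uniformly separated, so
   the group is discrete.  If g has finite order, then b_j = 0 whenever a_j = 0;
   starting from a_n = 0, the congruences give a = 0 by descending induction,
   hence b = 0: the group is torsion free.  It contains Z^n, because
   gamma_i^2 is the translation by e_(i+1), so the orbit space is an image of
   the unit cube.  The D_i generate the diagonal sign matrices with last entry
   1, which form (Z/2)^(n-1).  Finally, reversing the order of the coordinates
   maps the generators of Gamma_n to the generators of the Bott group of the
   matrix with 1s exactly on the superdiagonal. *)
Require Import Defs.
From mathcomp Require Import all_boot all_order all_algebra.
From mathcomp Require Import all_classical all_reals all_analysis.
From mathcomp Require Import perm.
From mathcomp Require Import zify lra.

Set Implicit Arguments.
Unset Strict Implicit.
Unset Printing Implicit Defensive.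

Import Order.TTheory GRing.Theory Num.Theory.
Import numFieldNormedType.Exports.

Local Open Scope classical_set_scope.
Local Open Scope ring_scope.
Local Open Scope quotient_scope.

(** * Subgroups, generators and conjugation *)

Section SubgroupTheory.
Variable G : groupType.
Implicit Types (H : subgroup G) (S : set G) (g h : G).

Lemma subgroup1 H : subgroup_set H 1%g.
Proof. exact: ((group_closed_setP _).1 (subgroup_closed H)).1. Qed.

Lemma subgroup_div H g h :
  subgroup_set H g -> subgroup_set H h -> subgroup_set H (g / h)%g.
Proof. exact: ((group_closed_setP _).1 (subgroup_closed H)).2. Qed.

Lemma subgroupV H g : subgroup_set H g -> subgroup_set H g^-1%g.
Proof. by move=> /(subgroup_div (subgroup1 H)); rewrite div1g. Qed.

Lemma subgroupM H g h :
  subgroup_set H g -> subgroup_set H h -> subgroup_set H (g * h)%g.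
Proof. by move=> Hg /subgroupV Hh; rewrite -[h]invgK; exact: subgroup_div. Qed.

Lemma mem_generated S g : S g -> subgroup_set (generated S) g.
Proof. by move=> Sg; exact: sub_gen_smallest. Qed.

Lemma generated_sub S H : S `<=` H -> generated S `<=` H.
Proof. by move=> SH; apply: smallest_sub => //; exact: subgroup_closed. Qed.

End SubgroupTheory.

(** Pulling a subgroup back along conjugation by [h] gives a subgroup again. Hence an inclusion
    between conjugated generated subgroups need only be checked on generators, as in
    [generated_conj]. *)
Lemma conjugate_group_closed (G : groupType) (H : subgroup G) (h : G) :
  group_closed (mem [set g | subgroup_set H (h * g * h^-1)%g]).
Proof.
apply/group_closed_setP; split=> [|u v /= Hu Hv].
  by rewrite /= mulg1 mulgV; exact: subgroup1.
have := subgroup_div Hu Hv.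
by rewrite !invgM invgK divgKA !mulgA.
Qed.

Lemma generated_conj (G : groupType) (S T : set G) (h : G) :
  (forall g, S g -> T (h * g * h^-1)%g) ->
  forall g, subgroup_set (generated S) g ->
    subgroup_set (generated T) (h * g * h^-1)%g.
Proof.
move=> ST; apply: (generated_sub
  (H := Subgroup (conjugate_group_closed (generated T) h))).
by move=> g /ST; exact: mem_generated.
Qed.

(** * Sign isometries and the half-integral group containing [Gamma] *)

Lemma sign_Z2D (R : pzRingType) (x y : 'Z_2) :
  (-1) ^+ (x + y)%R = (-1) ^+ x * (-1) ^+ y :> R.
Proof.
case: x y => [[|[|//]] ?] [[|[|//]] ?] /=;
  by rewrite ?expr0 ?expr1 ?mul1r ?mulr1 ?mulrNN ?mulr1.
Qed.

Lemma sign_Z2_inj (R : numDomainType) :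
  injective (fun x : 'Z_2 => (-1) ^+ x : R).
Proof.
move=> [[|[|//]] ?] [[|[|//]] ?] /= /eqP; rewrite ?expr0 ?expr1 => h;
  apply: val_inj => //=.
- by have := @ltrN10 R; rewrite -(eqP h) ltr10.
- by have := @ltrN10 R; rewrite (eqP h) ltr10.
Qed.

Section SignIsom.
Variables (R : realType) (n : nat).
Implicit Types (a : 'I_n -> 'Z_2) (b : 'I_n -> int) (x : 'cV[R]_n).

Lemma translationE (b : 'cV[R]_n) : translation b = sign_isom (fun=> 0%N) b.
Proof.
apply: val_inj; congr pair => /=; rewrite /sign_mx -diag_const_mx.
by congr diag_mx; apply/rowP => k; rewrite !mxE expr0.
Qed.

Lemma translationD (u v : 'cV[R]_n) :
  translation (u + v) = (translation u * translation v)%g.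
Proof.
apply: val_inj; congr pair; rewrite /= ?mulmx1 //.
by rewrite [lin _]/lin /= mul1mx addrC.
Qed.

Lemma act_translation (b x : 'cV[R]_n) : act (translation b) x = x + b.
Proof. by rewrite /act /lin /transl /= mul1mx. Qed.

Lemma sign_mxM (a a' : 'I_n -> nat) :
  sign_mx a *m sign_mx a' = sign_mx (fun k => a k + a' k)%N :> 'M[R]_n.
Proof.
rewrite /sign_mx mulmx_diag; congr diag_mx.
by apply/rowP => k; rewrite !mxE exprD.
Qed.

Lemma eq_sign_mx (a a' : 'I_n -> nat) :
  (forall k, (-1) ^+ a k = (-1) ^+ a' k :> R) ->
  sign_mx a = sign_mx a' :> 'M[R]_n.
Proof. by move=> e; congr diag_mx; apply/rowP => k; rewrite !mxE. Qed.

Lemma sign_mxE (a : 'I_n -> nat) i j :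
  sign_mx a i j = (-1) ^+ a j *+ (i == j) :> R.
Proof. by rewrite /sign_mx !mxE; case: eqVneq => [->|]. Qed.

Lemma act_signE (a : 'I_n -> nat) (b x : 'cV[R]_n) k :
  act (sign_isom a b) x k 0 = (-1) ^+ a k * x k 0 + b k 0.
Proof. by rewrite /act /lin /transl /= /sign_mx mul_diag_mx !mxE. Qed.

Lemma isom_ext (g h : isom R n) : lin g = lin h -> transl g = transl h -> g = h.
Proof.
move: g h => [[B b] ?] [[C c] ?]; rewrite /lin /transl /= => eB eb.
by apply: val_inj; rewrite /= eB eb.
Qed.

(** Translations are stored as integer numerators over 2, so that their parity can be compared with
    the sign exponents in ['Z_2]. *)
Definition half_isom a b : isom R n :=
  sign_isom (fun k => a k : nat) (\col_k ((b k)%:~R / 2)).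

(* The generators of Gamma, indexed by the coordinate that they translate. *)
Definition Gamma_gen (j : 'I_n) : isom R n :=
  if j == 0%N :> nat then translation (basis_vec j)
  else sign_isom (fun k => k.+1 == j) (2^-1 *: basis_vec j).

Lemma GammaE : Gamma R n = generated (range Gamma_gen).
Proof.
congr generated; apply/seteqP; split=> [g|_ [j _ <-]].
  case=> [[i /= i0 <-]|[i [j [ji ->]]]].
    by exists i => //; rewrite /Gamma_gen i0.
  exists j => //; rewrite /Gamma_gen ji /=.
  by congr sign_isom; apply/funext => k; rewrite ji eqSS.
rewrite /Gamma_gen; case: ifP => [/eqP j0|/negbT j0].
  by left; exists j.
right; have lt_j : (j.-1 < n)%N by apply: leq_ltn_trans (ltn_ord j); lia.
exists (Ordinal lt_j), j; split; first by rewrite /=; lia.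
congr sign_isom; apply/funext => k; congr nat_of_bool.
by rewrite -val_eqE /=; lia.
Qed.

(* Integrality of the first translation coordinate is not imposed: the larger
   group is already discrete and torsion free. *)
Definition half_group : set (isom R n) :=
  [set g | exists a b, [/\ g = half_isom a b,
     forall k : 'I_n, k.+1 = n -> a k = 0 &
     forall i j : 'I_n, j = i.+1 :> nat -> (b j)%:~R = a i]].

(** A sign matrix is its own inverse, so in a quotient the exponents add, and the second translation
    is subtracted after the product of both sign matrices has acted on it. *)
Lemma half_isom_div a b a' b' :
  (half_isom a b / half_isom a' b')%g =
  half_isom (fun k => a k + a' k)
            (fun k => b k - (-1) ^+ (a k + a' k)%R * b' k).
Proof.
rewrite -[LHS]/(isom_mul _ (isom_inv _)); apply: isom_ext.
  rewrite /lin /= /lin /= /sign_mx tr_diag_mx -![diag_mx _]/(sign_mx _) sign_mxM.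
  by apply: eq_sign_mx => k; rewrite exprD sign_Z2D.
apply/colP => k; rewrite /transl /lin /= /transl /= /lin /= /sign_mx.
rewrite tr_diag_mx mulmxN !mulmxA mulmx_diag mul_diag_mx !mxE.
by rewrite sign_Z2D rmorphB rmorphM rmorphM /= !rmorphXn rmorphN1; lra.
Qed.

Lemma half_group_closed : group_closed (mem half_group).
Proof.
apply/group_closed_setP; split.
  exists (fun=> 0), (fun=> 0); split=> //.
  rewrite -[LHS]/(translation 0) translationE.
  by apply: isom_ext => //; apply/colP => k; rewrite !mxE mul0r.
move=> _ _ [a [b [-> a0 ba]]] [a' [b' [-> a'0 ba']]].
rewrite half_isom_div; eexists; eexists; split; first by [].
- by move=> k kn; rewrite /= a0 // a'0 // addr0.
- move=> i j ji; rewrite rmorphB rmorphM /= (ba i) // (ba' i) //.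
  (* Modulo 2 the signs in front of [b'] disappear, so parities simply add, like the exponents. *)
  have N1 : -1 = 1 :> 'Z_2 by exact: val_inj.
  by rewrite rmorphXn rmorphN1 N1 expr1n mul1r -mulN1r N1 mul1r.
Qed.

Lemma Gamma_sub_half : Gamma R n `<=` half_group.
Proof.
rewrite GammaE; apply: (generated_sub (H := Subgroup half_group_closed)).
move=> _ [j _ <-]; rewrite /Gamma_gen; case: ifP => [/eqP j0|/negbT j0].
  (* A full unit translation has numerator 2, which is even, in accordance with the trivial
     signs. *)
  exists (fun=> 0), (fun k => (k == j)%:Z * 2); split=> //.
    rewrite translationE; apply: isom_ext => //; apply/colP => k.
    by rewrite !mxE andbT; case: eqP => _ /=; lra.
  by move=> i k ki; rewrite rmorphM /= (_ : 2%:~R = 0) ?mulr0 //; exact: val_inj.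
(* The only odd numerator is at [j] and the only negated coordinate is its predecessor. *)
exists (fun k => (k.+1 == j)%:R), (fun k => (k == j)%:Z); split=> //.
- apply: isom_ext; first by apply: eq_sign_mx => k; case: eqP.
  by apply/colP => k; rewrite !mxE andbT mulrC; case: eqP.
- by move=> k kn; rewrite kn gtn_eqF.
- by move=> i k ki; rewrite -val_eqE /= ki; case: eqP.
Qed.

Lemma half_group_torsion_free : torsion_free half_group.
Proof.
move=> g [a [b [-> a0 ba]]] m m0 gm1.
(* A coordinate that is not negated is merely shifted by [b i / 2] each time, so the shifts
   accumulate and never return to 0 unless [b i = 0]. *)
have powE i k : a i = 0 ->
    act (half_isom a b ^+ k)%g 0 i 0 = (b i)%:~R / 2 * k%:R.
  move=> ai0; elim: k => [|k IHk]; first by rewrite act1 mxE mulr0.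
  by rewrite expgS actM act_signE IHk ai0 expr0 mul1r mxE mulrSr; lra.
have b0 i : a i = 0 -> b i = 0.
  move=> ai0; have := powE i m ai0; rewrite gm1 act1 mxE => /esym/eqP.
  by rewrite !mulf_eq0 invr_eq0 !pnatr_eq0 (gtn_eqF m0) !orbF intr_eq0 => /eqP.
(* Here [d] is the distance to the last index. By induction [a] vanishes at [i + 1], hence so does
   [b], and the parity condition gives [a i = 0]. *)
have aE d : forall i : 'I_n, (i + d).+1 = n -> a i = 0.
  elim: d => [|d IHd] i; first by rewrite addn0; exact: a0.
  rewrite addnS => iE; have ltin : (i.+1 < n)%N by lia.
  rewrite -(ba i (Ordinal ltin)) //= b0 //; apply: IHd; rewrite /=; lia.
have {}aE i : a i = 0 by apply: (aE (n - i.+1)%N); have := ltn_ord i; lia.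
rewrite -[RHS]/(translation 0) translationE.
apply: isom_ext; first by apply: eq_sign_mx => k; rewrite aE.
by apply/colP => k; rewrite !mxE b0 // mul0r.
Qed.

(** Distinct signs are 2 apart and distinct half-integers at least 1/2 apart, so radius 1/4
    separates both components. *)
Lemma half_isom_ball_eq a b a' b' :
  ball (isom_val (half_isom a b)) 4^-1 (isom_val (half_isom a' b')) ->
  half_isom a b = half_isom a' b'.
Proof.
move=> [/= [_ ball_lin] [_ ball_transl]]; apply: isom_ext.
  apply: eq_sign_mx => k; have := ball_lin k k.
  rewrite /= !sign_mxE eqxx !mulr1n /ball /= => h.
  case: (a k) (a' k) h => [[|[|//]] ?] [[|[|//]] ?] /=;
    rewrite ?expr0 ?expr1 //.
  - by rewrite opprK ger0_norm; lra.
  - by rewrite ler0_norm; lra.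
apply/colP => k; have := ball_transl k 0.
rewrite /= !mxE /ball /= -mulrBl normrM [`|2^-1|]ger0_norm ?invr_ge0 //.
rewrite -rmorphB -intr_norm => h.
have {}h : (`|b k - b' k|%:~R < 1 :> R) by lra.
have /eqP : b k - b' k = 0 by move: h; rewrite ltrz1; lia.
by rewrite subr_eq0 => /eqP ->.
Qed.

Lemma half_group_discrete (A : set (isom R n)) :
  A `<=` half_group -> discrete_subset A.
Proof.
move=> AH g Ag; split; first exact: mem_set.
(* The topology is initial for [isom_val], so the preimage of a ball around the value of [g] is a
   neighbourhood of [g]. *)
exists (@isom_val R n @^-1` ball (isom_val g) 4^-1).
  apply: (@initial_continuous (isom R n) _ (@isom_val R n) g).
  by apply: nbhsx_ballx; rewrite invr_gt0.
apply/seteqP; split=> [h [/= + /AH]|_ ->]; last first.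
  by split=> //; apply: ballxx; rewrite invr_gt0.
have [a [b [-> _ _]]] := AH _ Ag => + [a' [b' [hE _ _]]].
by rewrite hE => hb; exact: esym (half_isom_ball_eq hb).
Qed.

End SignIsom.

(** * Orbits and compactness of the orbit space *)

Lemma orbit_piP (R : realType) n (Gam : subgroup (isom R n)) x y :
  \pi_(orbit_space Gam) x = \pi_(orbit_space Gam) y <->
  exists2 g, subgroup_set Gam g & y = act g x.
Proof.
split=> [/(@eqmodP _ (orbit_equiv Gam))/asboolP //|xy].
exact/(@eqmodP _ (orbit_equiv Gam))/asboolP.
Qed.

Lemma trmx_continuous (R : numFieldType) m n :
  continuous (trmx : 'M[R]_(m, n) -> 'M[R]_(n, m)).
Proof.
move=> A U /nbhs_ballP[e e0 eU]; apply/nbhs_ballP; exists e => // B [_ AB].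
by apply: eU; split=> // i j; rewrite !mxE; exact: AB.
Qed.

Lemma compact_orbit_space (R : realType) (n : nat) (Gam : subgroup (isom R n)) :
  (forall k, subgroup_set Gam (translation (basis_vec k))) ->
  compact [set: orbit_space Gam].
Proof.
move=> Gam_basis.
pose transl_in (v : 'cV[R]_n) := subgroup_set Gam (translation v).
have transl0 : transl_in 0 by exact: subgroup1.
have translD u v : transl_in u -> transl_in v -> transl_in (u + v).
  by rewrite /transl_in translationD; exact: subgroupM.
have translN u : transl_in u -> transl_in (- u).
  move=> /subgroupV; congr subgroup_set; apply: isom_ext.
    by rewrite /lin /= /lin /= trmx1.
  by rewrite /transl /= /lin /= trmx1 mul1mx.
have translMz k (z : int) : transl_in (z%:~R *: basis_vec k).
  have transl_nat (m : nat) : transl_in (m%:R *: basis_vec k).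
    elim: m => [|m IHm]; first by rewrite scale0r.
    by rewrite mulrSr scalerDl scale1r; exact: translD IHm (Gam_basis k).
  case: z => m; first by rewrite -pmulrn; exact: transl_nat.
  by rewrite NegzE rmorphN scaleNr; exact: translN (transl_nat _).
have transl_int (b : 'I_n -> int) : transl_in (\col_k (b k)%:~R).
  rewrite [X in transl_in X]matrix_sum_delta; apply: big_ind => // k _.
  by rewrite big_ord1 mxE; exact: translMz.
pose cube := [set v : 'rV[R]_n | forall k, `[0, 1]%classic (v ord0 k)].
have cube_compact : compact cube.
  apply: (@rV_compact R n (fun=> `[0, 1]%classic)) => k.
  exact: segment_compact.
(* The cube consists of row vectors, to which [rV_compact] applies; transposing and projecting it
   covers the orbit space continuously. *)
rewrite (_ : setT = (fun v : 'rV[R]_n => \pi_(orbit_space Gam) v^T) @` cube).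
  apply: continuous_compact cube_compact; apply: continuous_subspaceT.
  move=> v; apply: continuous_comp; last exact: pi_continuous.
  exact: trmx_continuous.
apply/seteqP; split=> // q _; rewrite -[q]reprK; set x := repr q.
(* The vector of fractional parts lies in the cube and differs from [x] by an integer
   translation. *)
exists (\row_k (x k 0 - (Num.floor (x k 0))%:~R)).
  move=> k; rewrite /= mxE in_itv /=.
  by have := floor_itv (x k 0); rewrite intrD; lra.
apply/orbit_piP.
exists (translation (\col_k (Num.floor (x k 0))%:~R)); first exact: transl_int.
by apply/colP => k; rewrite act_translation !mxE subrK.
Qed.

(** * Flatness and holonomy of [Gamma] *)

Section GammaGHW.
Variables (R : realType) (m : nat).
Local Notation n := m.+1.

(** The sign matrix negates only the coordinate before [j], so it fixes [basis_vec j] and the two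
    half translations add up. *)
Lemma Gamma_gen_sqr (j : 'I_n) : j != 0%N :> nat ->
  (Gamma_gen R j * Gamma_gen R j)%g = translation (basis_vec j).
Proof.
move=> j0; rewrite /Gamma_gen (negPf j0) translationE; apply: isom_ext.
  rewrite /lin /= sign_mxM; apply: eq_sign_mx => k.
  by rewrite addnn -mul2n exprM sqrrN expr1n expr1n.
apply/colP => k; rewrite /transl /lin /= mul_diag_mx !mxE andbT.
case: (k =P j) => [->|_] /=; last by rewrite !mulr0 addr0.
by rewrite gtn_eqF // expr0 mul1r mulr1 -mulr2n -[LHS]mulr_natr mulVf ?pnatr_eq0.
Qed.

Lemma Gamma_mem_gen (j : 'I_n) : subgroup_set (Gamma R n) (Gamma_gen R j).
Proof. by rewrite GammaE; apply: mem_generated; exists j. Qed.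

Lemma Gamma_basis (j : 'I_n) :
  subgroup_set (Gamma R n) (translation (basis_vec j)).
Proof.
have := Gamma_mem_gen j; have [j0|j0] := eqVneq (j : nat) 0%N.
  by rewrite /Gamma_gen j0.
by rewrite -Gamma_gen_sqr // => gj; exact: subgroupM.
Qed.

Lemma Gamma_flat : is_flat_manifold (Gamma R n).
Proof.
split.
- exact/half_group_discrete/Gamma_sub_half.
- by apply: compact_orbit_space; exact: Gamma_basis.
- by move=> g /Gamma_sub_half; exact: half_group_torsion_free.
Qed.

(* No generator negates the last coordinate, so the last exponent is 0. *)
Definition extend0 (u : 'rV['Z_2]_m) (k : 'I_n) : 'Z_2 :=
  oapp (u 0) 0 (unlift ord_max k).

Lemma extend0D u v k : extend0 (u + v) k = extend0 u k + extend0 v k.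
Proof. by rewrite /extend0; case: unlift => [i|] /=; rewrite ?mxE ?addr0. Qed.

Lemma extend0_lift u i : extend0 u (lift ord_max i) = u 0 i.
Proof. by rewrite /extend0 liftK. Qed.

Definition hol_mx (u : 'rV['Z_2]_m) : 'M[R]_n :=
  sign_mx (fun k => extend0 u k : nat).

Lemma hol_mxD u v : hol_mx (u + v) = hol_mx u *m hol_mx v.
Proof.
rewrite sign_mxM; apply: eq_sign_mx => k.
by rewrite extend0D sign_Z2D exprD.
Qed.

Lemma hol_mx_inj : injective hol_mx.
Proof.
move=> u v uv; apply/rowP => i; apply: (@sign_Z2_inj R).
have := congr1 (fun M : 'M[R]_n => M (lift ord_max i) (lift ord_max i)) uv.
by rewrite !sign_mxE eqxx !extend0_lift.
Qed.

Lemma hol_mx_holonomy u : holonomy (Gamma R n) (hol_mx u).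
Proof.
have hol0 : holonomy (Gamma R n) (hol_mx 0).
  exists 1%g; first exact: subgroup1.
  rewrite -[LHS]/(lin (translation 0)) translationE; apply: eq_sign_mx => k.
  by rewrite /extend0; case: unlift => [i|] //=; rewrite mxE.
(* Holonomy is closed under products and [hol_mx] turns sums into products, so basis vectors
   suffice. *)
rewrite [u]row_sum_delta; apply: (big_ind (fun u => holonomy _ (hol_mx u))) => //.
  move=> v w [g gG gv] [h hG hw]; rewrite hol_mxD -gv -hw.
  by exists (g * h)%g; first exact: subgroupM.
move=> i _; case: (u 0 i) => [[|[|//]] lt2].
  by rewrite (_ : Ordinal lt2 = 0) ?scale0r //; exact: val_inj.
rewrite (_ : Ordinal lt2 = 1) ?scale1r; last exact: val_inj.
(* The index [lift ord0 i] is [i + 1]: its generator negates coordinate [i], which is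
   [lift ord_max i]. *)
exists (Gamma_gen R (lift ord0 i)); first exact: Gamma_mem_gen.
rewrite /Gamma_gen /=; apply: eq_sign_mx => k; rewrite /extend0.
rewrite /bump /= add1n eqSS; case: unliftP => [l ->|->] /=.
  rewrite mxE eqxx -[bump _ _]/(lift ord_max l : nat) lift_max -val_eqE /= eq_sym.
  by case: eqP.
by rewrite gtn_eqF.
Qed.

Lemma holonomy_sub_hol_mx : holonomy (Gamma R n) `<=` range hol_mx.
Proof.
move=> _ [g /Gamma_sub_half[a [b [-> a0 _]]] <-].
exists (\row_i a (lift ord_max i)) => //; apply: eq_sign_mx => k.
rewrite /extend0; case: unliftP => [i ->|->] /=; first by rewrite mxE.
by rewrite a0.
Qed.

Lemma Gamma_GHW : GHW (Gamma R n).
Proof.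
split; first exact: Gamma_flat.
exists hol_mx; split; [exact: hol_mx_inj| |exact: hol_mxD].
apply/seteqP; split; last exact: holonomy_sub_hol_mx.
by move=> _ [u _ <-]; exact: hol_mx_holonomy.
Qed.

End GammaGHW.

(** * Conjugate groups have affinely diffeomorphic quotients *)

Lemma conj_affinely_diffeomorphic (R : realType) n (Gam Del : subgroup (isom R n))
    (h : isom R n) :
  (forall g, subgroup_set Gam g -> subgroup_set Del (h * g * h^-1)%g) ->
  (forall g, subgroup_set Del g -> subgroup_set Gam (h^-1 * g * h)%g) ->
  affinely_diffeomorphic Gam Del.
Proof.
move=> GD DG.
pose F (q : orbit_space Gam) := \pi_(orbit_space Del) (act h (repr q)).
pose F' (q : orbit_space Del) := \pi_(orbit_space Gam) (act (h^-1)%g (repr q)).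
(* Independence of the representative: if [x] is [g] applied to the chosen [r], then [h * g * h^-1]
   takes the image of [r] under [h] to that of [x]. *)
have FE x : F (\pi_(orbit_space Gam) x) = \pi_(orbit_space Del) (act h x).
  have /orbit_piP[g gG xE] := reprK (\pi_(orbit_space Gam) x).
  apply/orbit_piP; exists (h * g * h^-1)%g; first exact: GD.
  by rewrite [in LHS]xE -!actM divgK.
have F'E x :
    F' (\pi_(orbit_space Del) x) = \pi_(orbit_space Gam) (act (h^-1)%g x).
  have /orbit_piP[g gG xE] := reprK (\pi_(orbit_space Del) x).
  apply/orbit_piP; exists (h^-1 * g * h)%g; first exact: DG.
  by rewrite [in LHS]xE -!actM mulgK.
exists F; split.
  exists F' => q; rewrite -[q]reprK.
    by rewrite FE F'E -actM mulVg act1.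
  by rewrite F'E FE -actM mulgV act1.
exists (lin h), (transl h); split; last by move=> x; rewrite FE.
by have [] := mulmx1_unit (lin_mulT h).
Qed.

(** * Coordinate reversal and the Bott group *)

Section GammaRBM.
Variables (R : realType) (n : nat).

Definition rev_mx : 'M[R]_n := perm_mx (perm (@rev_ord_inj n)).

Lemma rev_mxE x i j : (rev_mx *m x : 'cV_n) i j = x (rev_ord i) j.
Proof. by rewrite -row_permE mxE permE. Qed.

Lemma rev_mxK : rev_mx *m rev_mx = 1%:M.
Proof.
rewrite -perm_mxM -perm_mx1; congr perm_mx; apply/permP => i.
by rewrite permM !permE rev_ordK.
Qed.

(** Both sides are inverse to [rev_mx]: the transpose as for any permutation matrix, [rev_mx] itself
    as an involution. *)
Lemma rev_mx_sym : rev_mx^T = rev_mx.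
Proof.
rewrite -[LHS]mul1mx -rev_mxK -mulmxA /rev_mx tr_perm_mx -[X in _ *m X]perm_mxM.
by rewrite mulgV perm_mx1 mulmx1.
Qed.

Lemma rev_mx_orth : orthogonal_mx rev_mx.
Proof. by rewrite /orthogonal_mx rev_mx_sym rev_mxK. Qed.

Definition rev_isom : isom R n := @Isom R n (rev_mx, 0) rev_mx_orth.

Lemma rev_isomV : (rev_isom^-1)%g = rev_isom.
Proof.
by apply: isom_ext; rewrite /lin /transl /= ?rev_mx_sym // mulmx0 oppr0.
Qed.

Lemma conj_sign_isom (a : 'I_n -> nat) b :
  (rev_isom * sign_isom a b * rev_isom^-1)%g =
  sign_isom (a \o @rev_ord n) (rev_mx *m b).
Proof.
rewrite rev_isomV; apply: isom_ext; last first.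
  by rewrite /lin /transl /= mulmx0 add0r /transl /= addr0.
rewrite /lin /=; apply/matrixP => i j.
rewrite -[in LHS]mulmxA -row_permE mxE permE /sign_mx mul_diag_mx !mxE permE.
by rewrite rev_ordK mulr_natr.
Qed.

Lemma rev_mx_basis (j : 'I_n) : rev_mx *m basis_vec j = basis_vec (rev_ord j).
Proof.
apply/colP => i; rewrite rev_mxE !mxE.
by rewrite -(inj_eq rev_ord_inj) rev_ordK.
Qed.

Definition superdiag : 'M['Z_2]_n := \matrix_(i, j) (j == i.+1 :> nat)%:R.

(* Reversing the coordinates turns "negate x_i, translate x_(i+1)" into
   "negate x_(i+1), translate x_i". *)
Lemma conj_Gamma_gen (j : 'I_n) :
  (rev_isom * Gamma_gen R j * rev_isom^-1)%g = bott_gen superdiag (rev_ord j).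
Proof.
rewrite /Gamma_gen /bott_gen /=.
(* Reversal sends index 0 to the last index, so the pure translations on both sides correspond. *)
have -> : ((n - j.+1).+1 == n) = (j == 0%N :> nat).
  by have := ltn_ord j; lia.
case: ifP => [_|/negbT j0].
  by rewrite translationE conj_sign_isom rev_mx_basis translationE.
rewrite conj_sign_isom -scalemxAr rev_mx_basis; congr sign_isom.
apply/funext => k /=; rewrite mxE /=; have := ltn_ord j; have := ltn_ord k.
move=> ltkn ltjn.
have -> : ((n - k.+1).+1 == j) = (k == (n - j.+1).+1 :> nat) by lia.
(* Up to the index [rev_ord j], [bott_gen] has exponent 0; there [k] cannot be its successor, so the
   exponents agree. *)
case: ltnP => [_|le_kj]; first by case: eqP.
by rewrite ltn_eqF.
Qed.

Lemma Gamma_RBM : RBM (Gamma R n).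
Proof.
exists superdiag; split.
  by move=> i j ji; rewrite mxE ltn_eqF.
rewrite GammaE; apply: (conj_affinely_diffeomorphic (h := rev_isom)).
  apply: generated_conj => _ [j _ <-]; rewrite conj_Gamma_gen.
  by exists (rev_ord j).
(* Writing the last factor as a double inverse makes this a conjugation by [rev_isom^-1], so
   [generated_conj] applies again. *)
move=> g; rewrite -[X in (_ * X)%g]invgK; move: g; apply: generated_conj.
move=> _ [j _ <-]; exists (rev_ord j) => //.
rewrite -[j in RHS]rev_ordK -conj_Gamma_gen !mulgA mulVg mul1g.
by rewrite mulgK.
Qed.

End GammaRBM.

Theorem proposition1 (R : realType) (n : nat) (hn : (2 <= n)%N) :
  GHW (Gamma R n) /\ RBM (Gamma R n).
Proof.
split; last exact: Gamma_RBM.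
(* With [n = m.+1] the rank [n.-1] becomes [m] and a last coordinate [ord_max] exists. *)
by case: n hn => // m _; exact: Gamma_GHW.
Qed.
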